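(* For a positive integer $n$, let $a(n)$ be the integer represented in base 2 by the bitstring obtained from the binary representation of $n$ by appending one $1$ to each run of $1$'s and one $0$ to each run of $0$'s. Call $a(n)$ a record value if $a(m)<a(n)$ for all positive integers $m<n$. Then the set of record values of $a$ is exactly the set of positive integers whose binary representation is an alternating sequence of $11$ and $00$ with at most one of the $00$'s replaced with $000$.
   Context: The binary representation of a positive integer $n$ is its usual base-2 expansion written with the most significant bit first and without leading zeros (so it starts with $1$). A run is a maximal block of consecutive equal bits. An alternating sequence of $11$ and $00$ is a concatenation of one or more blocks, each equal to $11$ or $00$, in which no two adjacent blocks are equal (the single block $11$ is included); as a binary representation it starts with the block $11$. For example, $n=89$ has binary representation $1011001$, and $a(89)$ has binary representation $110011100011$, so $a(89)=3299$. *)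

(* Defs.v *)
From mathcomp Require Import all_boot.

Set Implicit Arguments.
Unset Strict Implicit.
Unset Printing Implicit Defensive.

(* Bitstrings are read most significant bit first.                            *)

(* [bits 0] is the junk value [:: false].                                     *)
Definition bits (n : nat) : bitseq :=
  rev (mkseq (fun i => odd (n %/ 2 ^ i)) (trunc_log 2 n).+1).

Definition bitval (s : bitseq) : nat :=
  foldl (fun (v : nat) (b : bool) => v.*2 + b) 0 s.

Fixpoint runs (s : bitseq) : seq bitseq :=
  if s is b :: s' then
    if runs s' is r :: rs then
      if head b r == b then (b :: r) :: rs else [:: b] :: r :: rs
    else [:: [:: b]]
  else [::].

(* The default value of [last] is irrelevant: runs are nonempty.              *)
Definition lengthen_runs (s : bitseq) : bitseq :=
  flatten [seq rcons r (last false r) | r <- runs s].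

Definition a (n : nat) : nat := bitval (lengthen_runs (bits n)).

Example a_89 : a 89 = 3299. Proof. by vm_compute. Qed.

Definition record_value (v : nat) : Prop :=
  exists n : nat,
    [/\ 0 < n, v = a n & forall m : nat, 0 < m -> m < n -> a m < a n].

Definition b11 : bitseq := [:: true; true].
Definition b00 : bitseq := [:: false; false].
Definition b000 : bitseq := [:: false; false; false].

(* [sorted] only compares adjacent items; the relation need not be an order.  *)
Definition alternating_blocks (B : seq bitseq) : bool :=
  [&& B != [::],
      all (fun x => (x == b11) || (x == b00)) B
    & sorted (fun x y : bitseq => x != y) B].

Definition replace_at_most_one_00 (B B' : seq bitseq) : Prop :=
  B' = B \/
  exists i : nat,
    [/\ i < size B, nth [::] B i = b00 & B' = set_nth [::] B i b000].

(* When [s] is the binary representation of a positive integer it starts with *)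
(* 1, which forces the first block of [B] to be [b11].                        *)
Definition almost_alternating (s : bitseq) : Prop :=
  exists B B' : seq bitseq,
    [/\ alternating_blocks B, replace_at_most_one_00 B B' & s = flatten B'].

(* Main.v *)
Require Import Defs.
From mathcomp Require Import all_boot zify.

(** Appending a bit to a run is the same as doubling its first bit, so on
    bitstrings the map is [double_starts false], which reads the string from the
    left and doubles every bit that differs from the previous one; the imaginary
    bit 0 before the leading 1 makes the first run count.  Two facts drive the
    proof.  The output length is the length of the input plus its number of
    runs; it is at most twice the input length, with equality only for the
    alternating string [alt true L] ([size_double_starts], [full_size_alt]).
    And [double_starts] preserves the lexicographic order: at the first place
    where two inputs differ, the outputs differ in the same way
    ([double_starts_lt], [double_starts_mono]).

    Let [s] be the binary representation of [n], of length [L].  Then [n] is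
    the position of a record exactly when [s <= alt true L] and [s] has at
    least [L - 1] runs ([record_stringP]).  If both conditions hold, every
    smaller [m] has an image that is not longer; an image of the same length
    comes from a string of the same length [L], and monotonicity decides.  If
    [s > alt true L], then the image of [alt true L] is longer than that of [s].
    If [s < alt true L] has at most [L - 2] runs, then [alt true L.-1] already
    beats [s]: its image is at least as long, and [s] has a 0 at the first place
    where it leaves the alternating pattern.

    A string with [L] runs is alternating; one with [L - 1] runs is alternating
    except that one bit is repeated ([one_run_less]), and it is below
    [alt true L] exactly when that bit is a 0 ([critical_stringP]).  The images
    of these strings are the alternating sequences of 11 and 00 with at most one
    00 turned into 000 ([almost_alternatingP]). *)

Set Implicit Arguments.
Unset Strict Implicit.
Unset Printing Implicit Defensive.

(** * Bitstrings and their values *)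

Lemma bitval_acc v s :
  foldl (fun (v : nat) (b : bool) => v.*2 + b) v s = v * 2 ^ size s + bitval s.
Proof.
rewrite /bitval; elim: s v => [|b s IH] v /=; first by rewrite expn0 muln1 addn0.
by rewrite IH [in RHS]IH double0 add0n addnA mulnDl -muln2 -mulnA -expnS.
Qed.

Lemma bitval_cat s t : bitval (s ++ t) = bitval s * 2 ^ size t + bitval t.
Proof. by rewrite {1}/bitval foldl_cat bitval_acc. Qed.

Lemma bitval_cons b s : bitval (b :: s) = b * 2 ^ size s + bitval s.
Proof. by rewrite -cat1s bitval_cat. Qed.

Lemma bitval_ub s : bitval s < 2 ^ size s.
Proof.
elim: s => [|b s IH] //; rewrite bitval_cons /= expnS mul2n -addnn -addnS.
by rewrite leq_add //; case: b; rewrite ?mul1n.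
Qed.

Lemma bitval_lb s : head false s -> 2 ^ (size s).-1 <= bitval s.
Proof. by case: s => [|[] s] //= _; rewrite bitval_cons mul1n leq_addr. Qed.

Lemma bitval_gt0 s : head false s -> 0 < bitval s.
Proof. by move/bitval_lb; apply: leq_trans; rewrite expn_gt0. Qed.

Lemma bitval_lt_size s t :
  head false t -> size s < size t -> bitval s < bitval t.
Proof.
move=> ht lt_st; apply: leq_trans (bitval_ub s) (leq_trans _ (bitval_lb ht)).
by rewrite leq_exp2l //; case: (size t) lt_st.
Qed.

Lemma bitval_lt_cat p x y :
  size x = size y -> bitval (p ++ false :: x) < bitval (p ++ true :: y).
Proof.
move=> exy; rewrite !bitval_cat !bitval_cons /= exy mul0n mul1n ltn_add2l add0n.
by apply: leq_trans (leq_addr _ _); rewrite -exy bitval_ub.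
Qed.

Lemma first_difference (s t : bitseq) : size s = size t -> s <> t ->
  exists p b x y,
    [/\ s = p ++ b :: x, t = p ++ ~~ b :: y & size x = size y].
Proof.
elim: s t => [|b s IH] [|c t] //= [est] ne_st.
have [ebc|nbc] := eqVneq b c; last first.
  by exists [::], b, s, t; rewrite /=; split=> //; case: b c nbc {ne_st} => [] [].
have [|p [d [x [y [-> -> exy]]]]] := IH t est.
  by move=> e; apply: ne_st; rewrite ebc e.
by exists (b :: p), d, x, y; rewrite ebc.
Qed.

Lemma bitval_lt_split s t : size s = size t -> bitval s < bitval t ->
  exists p x y,
    [/\ s = p ++ false :: x, t = p ++ true :: y & size x = size y].
Proof.
move=> est lt_st; have [|p [b [x [y [es et exy]]]]] := first_difference est.
  by move=> e; rewrite e ltnn in lt_st.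
case: b es et => /= es et; last by exists p, x, y.
by move: lt_st; rewrite es et ltnNge ltnW // bitval_lt_cat.
Qed.

Lemma size_le_bitval s t :
  head false s -> bitval s <= bitval t -> size s <= size t.
Proof. by move=> hs; apply: contraTT; rewrite -!ltnNge; apply: bitval_lt_size. Qed.

Lemma bitval_inj s t :
  head false s -> head false t -> bitval s = bitval t -> s = t.
Proof.
move=> hs ht est; apply/eqP/negPn/negP => /eqP nst.
have [|p [b [x [y [es et exy]]]]] := first_difference _ nst.
  by apply/eqP; rewrite eqn_leq !size_le_bitval ?est.
have := bitval_lt_cat p exy; have := bitval_lt_cat p (esym exy).
by rewrite es et in est; case: b {es et} est => /= ->; rewrite ltnn.
Qed.

Lemma bitsK n : bitval (bits n) = n.
Proof.
rewrite /bitval /bits foldl_rev.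
move: (trunc_log 2 n).+1 (@trunc_log_ltn 2 n isT) => k.
elim: k n => [|k IH] n.
  by rewrite expn0 ltnS leqn0 => /eqP->.
rewrite expnS => ltn; rewrite /mkseq /= divn1.
rewrite (iotaDl 1 0) -map_comp (eq_map (g := fun i => odd (n./2 %/ 2 ^ i))).
  rewrite [foldr _ _ _]IH ?[RHS](esym (odd_double_half n)) 1?addnC //.
  by rewrite ltn_half_double -mul2n.
by move=> i /=; rewrite add1n expnS divnMA divn2.
Qed.

Lemma head_bits n : 0 < n -> head false (bits n).
Proof.
move=> n0; rewrite /bits mkseqS rev_rcons /=.
have -> // : n %/ 2 ^ trunc_log 2 n = 1.
apply/eqP; rewrite eqn_leq leq_divRL ?expn_gt0 // mul1n trunc_logP // andbT.
by rewrite -ltnS ltn_divLR ?expn_gt0 // -expnS trunc_log_ltn.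
Qed.

Lemma bitvalK s : head false s -> bits (bitval s) = s.
Proof. by move=> hs; apply: bitval_inj; rewrite ?head_bits ?bitval_gt0 ?bitsK. Qed.

(** * Lengthening runs by doubling their first bits *)

(** The argument [c] is the bit that precedes [s]. *)
Fixpoint double_starts (c : bool) (s : bitseq) : bitseq :=
  if s is d :: s' then d :: nseq (c != d) d ++ double_starts d s' else [::].

Lemma lengthen_runs_cons b s :
  lengthen_runs (b :: s) = double_starts (~~ b) (b :: s).
Proof.
rewrite /lengthen_runs.
(* The induction needs that the first run starts with [b]. *)
suff [r [rs [-> ->]]] : exists r rs, runs (b :: s) = (b :: r) :: rs /\
    flatten [seq rcons r (last false r) | r <- (b :: r) :: rs]
      = double_starts (~~ b) (b :: s) by [].
elim: s b => [|d s IH] b; first by exists [::], [::]; case: b.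
have [r [rs [er]]] := IH d; rewrite [runs (b :: _)]/= -/(runs (d :: s)) er /=.
have [<-|ndb] := eqVneq d b => /= ef.
  exists (d :: r), rs; split=> //=.
  by case: d er ef => er /= [->].
exists [::], ((d :: r) :: rs); split=> //=.
by case: b d ndb er ef => [] [] //= _ _ [->].
Qed.

Lemma lengthen_runsE s :
  head false s -> lengthen_runs s = double_starts false s.
Proof. by case: s => [|[] s] // _; rewrite lengthen_runs_cons. Qed.

Lemma head_double_starts c s : head false (double_starts c s) = head false s.
Proof. by case: s. Qed.

Lemma double_starts_cat c s t :
  double_starts c (s ++ t) = double_starts c s ++ double_starts (last c s) t.
Proof. by elim: s c => //= d s IH c; rewrite IH catA. Qed.

(** At the first difference both outputs contain the bit of their own input
    string, whether or not it starts a run. *)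
Lemma double_starts_lt c p x y :
    size (double_starts c (p ++ false :: x))
      = size (double_starts c (p ++ true :: y)) ->
  bitval (double_starts c (p ++ false :: x))
    < bitval (double_starts c (p ++ true :: y)).
Proof.
rewrite !double_starts_cat /= => es; apply: bitval_lt_cat.
by move: es; rewrite !(size_cat (double_starts c p)) => /addnI[].
Qed.

Lemma double_starts_mono c s t :
    size s = size t -> size (double_starts c s) = size (double_starts c t) ->
  bitval s < bitval t -> bitval (double_starts c s) < bitval (double_starts c t).
Proof.
move=> est eD /(bitval_lt_split est) [p [x [y [es et _]]]].
by rewrite es et in eD *; apply: double_starts_lt.
Qed.

Lemma size_double_starts c s : size (double_starts c s) <= (size s).*2.
Proof.
elim: s c => //= d s IH c; rewrite doubleS ltnS size_cat size_nseq.
by rewrite -add1n leq_add // leq_b1.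
Qed.

(** * Alternating strings *)

Fixpoint alt (b : bool) (n : nat) : bitseq :=
  if n is n'.+1 then b :: alt (~~ b) n' else [::].

Lemma size_alt b n : size (alt b n) = n.
Proof. by elim: n b => //= n IH b; rewrite IH. Qed.

Lemma altD b m n : alt b (m + n) = alt b m ++ alt (b (+) odd m) n.
Proof.
elim: m b => [|m IH] b /=; first by rewrite addbF.
by rewrite IH addNb addbN.
Qed.

Lemma alt_rcons b n : alt b n.+1 = rcons (alt b n) (b (+) odd n).
Proof. by rewrite -addn1 altD cats1. Qed.

Lemma last_alt c n : last c (alt (~~ c) n) = c (+) odd n.
Proof.
elim: n c => [|n IH] c /=; first by rewrite addbF.
by rewrite IH addNb addbN.
Qed.

Lemma head_alt n : 0 < n -> head false (alt true n).
Proof. by case: n. Qed.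

Definition pair_of (b : bool) : bitseq := [:: b; b].

Lemma double_starts_alt c n :
  double_starts c (alt (~~ c) n) = flatten [seq pair_of b | b <- alt (~~ c) n].
Proof. by elim: n c => //= n IH c; rewrite IH; case: c. Qed.

Lemma size_double_starts_alt c n : size (double_starts c (alt (~~ c) n)) = n.*2.
Proof.
by elim: n c => //= n IH c; rewrite size_cat IH size_nseq doubleS; case: c.
Qed.

Lemma full_size_alt c s :
  size (double_starts c s) = (size s).*2 -> s = alt (~~ c) (size s).
Proof.
elim: s c => //= d s IH c; rewrite doubleS size_cat size_nseq => -[].
case: (eqVneq c d) => [_|ncd]; last first.
  rewrite add1n => -[/IH es]; have ->: ~~ c = d by case: c d ncd {es} => [] [].
  by rewrite {1}es.
by rewrite add0n => e; have := size_double_starts d s; rewrite e ltnn.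
Qed.

Lemma one_run_less c s : (size (double_starts c s)).+1 = (size s).*2 ->
  exists i j, let b := c (+) odd i in s = alt (~~ c) i ++ b :: alt (~~ b) j.
Proof.
elim: s c => //= d s IH c; rewrite doubleS size_cat size_nseq => -[].
case: (eqVneq c d) => [<-|ncd].
  by rewrite add0n => /full_size_alt->; exists 0, (size s); rewrite /= addbF.
rewrite add1n => /IH [i [j es]]; exists i.+1, j.
have edc: d = ~~ c by case: c d ncd {es} => [] [].
by rewrite es edc /= addNb addbN.
Qed.

(** * Strings of record positions *)

Definition record_string (s : bitseq) : Prop :=
  forall u, head false u -> bitval u < bitval s ->
    bitval (double_starts false u) < bitval (double_starts false s).

Lemma record_stringP s : head false s ->
  record_string s <->
    bitval s <= bitval (alt true (size s))
    /\ (size s).*2 <= (size (double_starts false s)).+1.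
Proof.
move=> hs; have s_gt0 : 0 < size s by case: s hs.
set L := size s in s_gt0 *.
have D_alt k : size (double_starts false (alt true k)) = k.*2.
  exact: (size_double_starts_alt false).
have hD t : head false t -> head false (double_starts false t).
  by rewrite head_double_starts.
split=> [rec_s | [le_sA runs_s] u hu lt_us]; last first.
  have le_uL : size u <= L by apply: size_le_bitval => //; apply: ltnW.
  (* A longer image would force [u = alt true L], which is not below [s]. *)
  have le_D : size (double_starts false u) <= size (double_starts false s).
    rewrite leqNgt; apply/negP => lt_D.
    have full : L.*2 <= size (double_starts false u) := leq_trans runs_s lt_D.
    have eL : size u = L.
      apply/eqP; rewrite eqn_leq le_uL -leq_double.
      exact: leq_trans full (size_double_starts _ _).
    have eu : u = alt true L.
      rewrite -eL; apply: (@full_size_alt false).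
      by apply/eqP; rewrite eqn_leq size_double_starts eL.
    by move: lt_us; rewrite ltnNge eu le_sA.
  have [lt_D|ge_D] := ltnP (size (double_starts false u))
                           (size (double_starts false s)).
    by apply: bitval_lt_size; rewrite ?hD.
  have eD : size (double_starts false u) = size (double_starts false s).
    by apply/eqP; rewrite eqn_leq le_D.
  apply: double_starts_mono => //; apply/eqP; rewrite eqn_leq le_uL /=.
  by have := size_double_starts false u; lia.
have le_sA : bitval s <= bitval (alt true L).
  rewrite leqNgt; apply/negP => lt_As.
  have /(size_le_bitval (hD _ (head_alt s_gt0))) :=
    ltnW (rec_s _ (head_alt s_gt0) lt_As).
  rewrite D_alt => ge_D.
  have es : s = alt true L.
    apply: (@full_size_alt false).
    by apply/eqP; rewrite eqn_leq size_double_starts.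
  by rewrite {1}es ltnn in lt_As.
split=> //; rewrite leqNgt; apply/negP => few_runs.
have lt_sA : bitval s < bitval (alt true L).
  rewrite ltn_neqAle le_sA andbT; apply/eqP => /bitval_inj e.
  by move: few_runs; rewrite e ?head_alt // D_alt ltnNge leqnSn.
have [|p [x [y [es eA exy]]]] := bitval_lt_split _ lt_sA.
  by rewrite size_alt.
have L_gt1 : 1 < L.
  by move: hs; rewrite /L es size_cat /=; case: (p) => //= *; lia.
have hA' : head false (alt true L.-1) by rewrite head_alt //; lia.
have /(rec_s _ hA') : bitval (alt true L.-1) < bitval s.
  by apply: bitval_lt_size; rewrite // size_alt -/L; lia.
have [lt_D|ge_D] := ltnP (size (double_starts false s)) L.-1.*2.
  by rewrite ltnNge ltnW // bitval_lt_size ?hD ?D_alt.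
have eA' : rcons (alt true L.-1) (~~ odd L.-1) = p ++ true :: y.
  by rewrite -eA -{3}(prednK s_gt0) alt_rcons.
case/lastP: y eA' {eA} exy => [|y z] eA' exy.
  (* Only the last bit of [s] could then continue a run. *)
  move: eA'; rewrite cats1 => /rcons_inj [ep _].
  move: few_runs; rewrite es double_starts_cat size_cat -ep D_alt /=; lia.
move: eA'; rewrite -rcons_cons -rcons_cat => /rcons_inj [eA' _].
rewrite ltnNge ltnW // es eA' double_starts_lt // -es -eA' D_alt; lia.
Qed.

(** * Strings with at most one repeated bit *)

Lemma critical_stringP s : head false s ->
  (bitval s <= bitval (alt true (size s))
    /\ (size s).*2 <= (size (double_starts false s)).+1)
  <-> s = alt true (size s)
      \/ exists i j, ~~ odd i /\ s = alt true i ++ false :: alt true j.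
Proof.
move=> hs; split=> [[le_sA runs_s] | [->|[i [j [ei es]]]]]; last 1 first.
- split.
    have -> : alt true (size s) = alt true i ++ true :: alt false j.
      by rewrite es size_cat /= !size_alt altD /= (negbTE ei).
    by rewrite es ltnW // bitval_lt_cat ?size_alt.
  rewrite es double_starts_cat (last_alt false) /= (negbTE ei) /=.
  rewrite !size_cat /= !(size_double_starts_alt false) !size_alt; lia.
- have [eD|nD] := eqVneq (size (double_starts false s)) (size s).*2.
    by left; apply: (@full_size_alt false).
  have [|i [j /=]] := @one_run_less false s.
    by have := size_double_starts false s; lia.
  have [oi|ei] := boolP (odd i) => /= es; last by right; exists i, j.
  (* The repeated bit is a 1 where the alternating string has a 0. *)
  move: le_sA; rewrite leqNgt => /negP[].
  have -> : alt true (size s) = alt true i ++ false :: alt true j.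
    by rewrite es size_cat /= !size_alt altD /= oi.
  by rewrite es bitval_lt_cat ?size_alt.
- by rewrite size_alt leqnn (size_double_starts_alt false).
Qed.

(** * Alternating blocks *)

Lemma alternating_blocksP B : alternating_blocks B <->
  exists b n, 0 < n /\ B = [seq pair_of c | c <- alt b n].
Proof.
split=> [|[b [n [n_gt0 ->]]]].
  case: B => [|x B] // /and3P[_]; rewrite [all _ _]/= => /andP[px].
  have [b ->] : exists b, x = pair_of b.
    by case/orP: px => /eqP->; [exists true | exists false].
  rewrite [sorted _ _]/= => {px x} aB sB; exists b, (size B).+1; split=> //=.
  congr cons; elim: B b aB sB => [|x B IH] b //= /andP[px aB] /andP[nx sB].
  have ex : x = pair_of (~~ b).
    by case/orP: px nx => /eqP->; case: b {sB}.
  by rewrite ex in sB *; rewrite -IH.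
case: n n_gt0 => // n _; apply/and3P; split=> //.
  by apply/allP => x /mapP[[] _ ->].
rewrite /=; elim: n b => //= n IH b; rewrite IH andbT.
by case: b.
Qed.

Lemma nth_alt b n i : i < n -> nth false (alt b n) i = b (+) odd i.
Proof.
elim: n i b => [|n IH] [|i] b //=; first by rewrite addbF.
by rewrite ltnS => /IH->; rewrite addNb addbN.
Qed.

Lemma set_nth_size_cat (T : Type) (x0 : T) s y t z :
  set_nth x0 (s ++ y :: t) (size s) z = s ++ z :: t.
Proof. by elim: s => //= x s ->. Qed.

(** The bit inserted after the 0 that ends [alt true i.+1] lengthens its pair
    to 000; the 1 that follows then starts an ordinary block. *)
Lemma double_starts_repeat0 i j : odd i ->
  double_starts false (alt true i.+1 ++ false :: alt true j)
    = flatten (set_nth [::] [seq pair_of c | c <- alt true (i + j.+1)] i b000).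
Proof.
move=> oi; rewrite double_starts_cat !(double_starts_alt false) (last_alt false).
rewrite alt_rcons map_rcons flatten_rcons altD map_cat /= oi /=.
rewrite -{3}(size_alt true i) -(size_map pair_of) set_nth_size_cat.
by rewrite (double_starts_alt false) flatten_cat -catA.
Qed.

Lemma almost_alternatingP t : head false t ->
  almost_alternating t <->
  exists s, [/\ head false s, t = double_starts false s &
    s = alt true (size s)
    \/ exists i j, ~~ odd i /\ s = alt true i ++ false :: alt true j].
Proof.
move=> ht; split=> [[B [B' [/alternating_blocksP [b [n [n_gt0 eB]]] repB et]]]|].
  (* The first bit of [t] is that of the first block, even if replaced. *)
  have eb : b = true.
    case: b eB => // eB; case: n n_gt0 eB => // n _ eB.
    case: repB => [eB'|[[|i] [_ _ eB']]];
      by rewrite et eB' eB in ht.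
  rewrite {b}eb in eB; case: repB => [eB'|[i [lt_i nth_i eB']]].
    exists (alt true n); rewrite head_alt // (double_starts_alt false) size_alt.
    by rewrite et eB' eB; split=> //; left.
  rewrite eB size_map size_alt in lt_i.
  have oi : odd i.
    move: nth_i; rewrite eB (nth_map false) ?size_alt // nth_alt //.
    by case: (odd i).
  exists (alt true i.+1 ++ false :: alt true (n - i.+1)); split=> //.
    by rewrite double_starts_repeat0 // addnS -addSn subnKC // et eB' eB.
  by right; exists i.+1, (n - i.+1); rewrite /= oi.
case=> s [hs -> [es|[i [j [ei es]]]]].
  pose B := [seq pair_of c | c <- alt true (size s)].
  exists B, B; split; last 1 first.
  - by rewrite {1}es (double_starts_alt false).
  - by apply/alternating_blocksP; exists true, (size s); split=> //; case: (s) hs.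
  - by left.
case: i ei es => [|i] /= oi es; first by rewrite es in hs.
rewrite negbK in oi; rewrite es.
pose B := [seq pair_of c | c <- alt true (i + j.+1)].
exists B, (set_nth [::] B i b000); split; last 1 first.
- exact: double_starts_repeat0.
- by apply/alternating_blocksP; exists true, (i + j.+1); split=> //; rewrite addnS.
right; exists i; rewrite /B size_map size_alt addnS ltnS leq_addr; split=> //.
by rewrite (nth_map false) ?size_alt ?nth_alt ?oi // leq_addr.
Qed.

Theorem mainTheorem3 :
  forall v : nat,
    record_value v <-> (0 < v /\ almost_alternating (bits v)).
Proof.
move=> v; split.
  case=> n [n_gt0 ev rec_n]; have hs := head_bits n_gt0.
  have aE m : 0 < m -> a m = bitval (double_starts false (bits m)).
    by move=> m_gt0; rewrite /a lengthen_runsE ?head_bits.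
  have hD : head false (double_starts false (bits n)).
    by rewrite head_double_starts.
  rewrite ev aE // bitvalK // bitval_gt0 //; split=> //.
  apply/(almost_alternatingP hD); exists (bits n); split=> //.
  apply/(critical_stringP hs)/(record_stringP hs) => u hu.
  rewrite bitsK => /(rec_n _ (bitval_gt0 hu)).
  by rewrite !aE ?bitval_gt0 // bitvalK.
case=> v_gt0 /(almost_alternatingP (head_bits v_gt0)) [s [hs ev crit_s]].
exists (bitval s); rewrite bitval_gt0 // /a bitvalK // lengthen_runsE //.
split=> // [|m m_gt0 lt_m]; first by rewrite -ev bitsK.
have hm := head_bits m_gt0; rewrite lengthen_runsE //.
have /(record_stringP hs) rec_s := (critical_stringP hs).2 crit_s.
by apply: rec_s; rewrite ?bitsK.
Qed.
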